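(* Let $Y(s_1,\dots,s_n)$ be a Gaussian field with $\mathsf{E}[Y(s_1,\dots,s_n)]=0$ for all $(s_1,\dots,s_n)\in[0,\infty)^n$, and covariance function $$\mathsf{E}\bigl[Y(s_1,\dots,s_n)Y(t_1,\dots,t_n)\bigr]=\prod_{i=1}^{n}u_i(s_i\wedge t_i)\,v_i(s_i\vee t_i)$$ for all $(s_1,\dots,s_n),(t_1,\dots,t_n)\in[0,\infty)^n$, where $u_i,v_i$, $i=1,\dots,n$, are functions of one variable. If the functions $a_i(t)=\dfrac{v_i(t)}{u_i(t)}$, $i=1,\dots,n$, are decreasing and continuous, then the field $$Z(t_1,\dots,t_n)=\frac{Y\bigl(a_1^{-1}(t_1),\dots,a_n^{-1}(t_n)\bigr)}{u_1\bigl(a_1^{-1}(t_1)\bigr)\cdots u_n\bigl(a_n^{-1}(t_n)\bigr)}$$ is stochastically equivalent to the Brownian sheet $X(t_1,\dots,t_n)$, where $a_i^{-1}(\cdot)$, $i=1,\dots,n$, denotes the inverse of $a_i(\cdot)$.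
   Context: $\wedge$ denotes minimum and $\vee$ denotes maximum. Let $K=[0,1]^n$. A real-valued separable Gaussian stochastic process $\{X(s_1,\dots,s_n),\ (s_1,\dots,s_n)\in K\}$ is called a Brownian sheet with $n$ parameters if (1) $X(s_1,\dots,s_n)=0$ whenever $s_1\cdots s_n=0$; (2) $\mathsf{E}[X(s_1,\dots,s_n)]=0$ for all $(s_1,\dots,s_n)\in K$; (3) $\mathsf{E}[X(s_1,\dots,s_n)X(t_1,\dots,t_n)]=\prod_{i=1}^n\min\{s_i,t_i\}$ for all $(s_1,\dots,s_n),(t_1,\dots,t_n)\in K$. Processes $\xi(t)$ and $\xi^*(t)$ (and likewise fields, with $t$ a multidimensional parameter) with parameter set $T$ are said to be stochastically equivalent if $\mathsf{P}\{\xi(t)=\xi^*(t)\}=1$ for all $t\in T$. *)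

(* Defs.v *)
From HB Require Import structures.
From mathcomp Require Import all_boot all_order all_algebra.
From mathcomp Require Import all_classical all_reals all_analysis.
Set Implicit Arguments.
Unset Strict Implicit.
Unset Printing Implicit Defensive.
Import Order.TTheory GRing.Theory Num.Theory.
Import numFieldNormedType.Exports.
Local Open Scope classical_set_scope.
Local Open Scope ring_scope.

Section parameter_sets.
Context {R : realType} {n : nat}.
Implicit Types t : 'rV[R]_n.

Definition orthant : set 'rV[R]_n := [set t | forall i, 0 <= t 0 i].

Definition unit_cube : set 'rV[R]_n := [set t | forall i, 0 <= t 0 i <= 1].

Definition coordinate_faces : set 'rV[R]_n := [set t | \prod_(i < n) t 0 i = 0].

End parameter_sets.

(* A process is a total family of random variables indexed by row vectors; only
   its values on the parameter set T are constrained. *)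
Section processes.
Context {R : realType} {d : measure_display} {Omega : measurableType d}.
Variables (P : probability Omega R) (n : nat).
Implicit Types (T : set 'rV[R]_n) (X : 'rV[R]_n -> {RV P >-> R}).

(* Degenerate laws have to be allowed separately: the library's
   [normal_prob m 0] is the uniform law on [0, 1], not the Dirac mass at m. *)
Definition gaussian_law (mu : set R -> \bar R) : Prop :=
  (exists m : R, forall A, measurable A -> mu A = \d_m A) \/
  (exists m s : R, 0 < s /\ forall A, measurable A -> mu A = normal_prob m s A).

(* All finite-dimensional distributions are (possibly degenerate) Gaussian,
   i.e., every finite linear combination of values has a Gaussian law. *)
Definition gaussian_process T X : Prop :=
  forall (k : nat) (t : 'I_k -> 'rV[R]_n) (c : 'I_k -> R),
    (forall j, T (t j)) ->
    gaussian_law (pushforward P (fun w => \sum_(j < k) c j * X (t j) w)).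

(* Doob separability: the countable set S is a separant, N the exceptional
   null set. *)
Definition separable_process T X : Prop :=
  exists (S : set 'rV[R]_n) (N : set Omega),
    [/\ countable S, S `<=` T, T `<=` closure S, P.-negligible N &
      forall (G : set 'rV[R]_n) (F : set R) (w : Omega),
        open G -> closed F -> ~ N w ->
        (forall t, (S `&` G) t -> F (X t w)) ->
        forall t, (T `&` G) t -> F (X t w)].

(* The Brownian sheet with n parameters is the case T = unit_cube; a smaller
   T is used for fields that only make sense on a part of the cube. *)
Record brownian_sheet T X : Prop := BrownianSheet {
  sheet_separable : separable_process T X ;
  sheet_gaussian : gaussian_process T X ;
  sheet_faces : forall s, T s -> \prod_(i < n) s 0 i = 0 ->
    forall w, X s w = 0 ;
  sheet_mean : forall s, T s -> ('E_P[X s] = 0)%E ;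
  sheet_covariance : forall s t, T s -> T t ->
    ('E_P[(X s \* X t)%R])%E = (\prod_(i < n) Num.min (s 0 i) (t 0 i))%:E }.

Definition stochastically_equivalent T (xi xi' : 'rV[R]_n -> Omega -> R) : Prop :=
  forall t, T t -> P [set w | xi t w = xi' t w] = 1%E.

End processes.

Section time_changes.
Context {R : realType}.
Implicit Types u v : R -> R.

Definition time_change u v : R -> R := fun t => v t / u t.

(* The set on which v / u makes sense as a function on [0, +oo[ (division by
   zero is total in the library). *)
Definition time_change_dom u : set R := [set t | 0 <= t /\ u t != 0].

Definition time_change_range u v : set R := time_change u v @` time_change_dom u.

(* Inverse of v / u on its domain; meaningful on [time_change_range u v] only. *)
Definition time_change_inv u v : R -> R := pinv (time_change_dom u) (time_change u v).

Context {Omega : Type} {n : nat}.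
Variables (u v : 'I_n -> R -> R) (Y : 'rV[R]_n -> Omega -> R).

Definition normalized_field (t : 'rV[R]_n) : Omega -> R := fun w =>
  Y (\row_i time_change_inv (u i) (v i) (t 0 i)) w /
  \prod_(i < n) u i (time_change_inv (u i) (v i) (t 0 i)).

(* The points of the cube at which all the inverses are defined. *)
Definition normalized_dom : set 'rV[R]_n :=
  unit_cube `&` [set t | forall i, time_change_range (u i) (v i) (t 0 i)].

(* On the coordinate faces a Brownian sheet vanishes, hence needs no inverse:
   typically 0 is only the limit of v / u at infinity. *)
Definition sheet_dom : set 'rV[R]_n :=
  normalized_dom `|` (unit_cube `&` coordinate_faces).

Lemma sheet_dom_full :
  (forall i x, 0 < x <= 1 -> time_change_range (u i) (v i) x) ->
  sheet_dom = unit_cube.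
Proof.
move=> H; apply/seteqP; split=> [t [[]//|[]//]|t Kt].
have [t0|tn0] := eqVneq (\prod_(i < n) t 0 i) 0; first by right.
left; split=> // i; apply: H.
move/prodf_neq0: tn0 => /(_ i isT) ti0.
by have /andP[ti ->] := Kt i; rewrite andbT lt_neqAle eq_sym ti0.
Qed.

End time_changes.

(* Main.v *)
Require Import Defs.
From mathcomp Require Import all_boot all_order all_algebra.
From mathcomp Require Import all_classical all_reals all_analysis.
From mathcomp Require Import measurable_realfun.
From mathcomp Require Import ring lra.
Import Order.TTheory GRing.Theory Num.Theory.
Import numFieldNormedType.Exports.
Local Open Scope classical_set_scope.
Local Open Scope ring_scope.

(** If x_i and y_i lie in the domain of a_i = v_i / u_i
    and x_i <= y_i, then u_i(x_i) v_i(y_i) / (u_i(x_i) u_i(y_i)) = a_i(y_i),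
    and this is the smaller of a_i(x_i) and a_i(y_i) because a_i decreases
    (time_change_min). Dividing Y by the product of the u_i and
    reparametrizing by the inverses of the a_i therefore turns the given
    covariance into \prod_i min(s_i, t_i), and the field stays centered and
    Gaussian since each of its values is a multiple of a value of Y.

    What remains is that a centered Gaussian field Z on a part T of the unit
    cube, with that covariance, agrees almost surely at each point with a real
    field that is separable and vanishes on the coordinate faces
    (brownian_sheet_modification). On a face the variance \prod_i t_i is zero,
    so Z can be replaced there by 0. Off the faces the modification is
    produced by Kolmogorov's chaining argument (separable_modification): the
    variance of Z s - Z t is at most 2 n |s - t| (sheet_increment_le); for
    Gaussian variables the moment of order 2m is bounded by a constant times
    the m-th power of the second moment (gaussian_moment_le); hence E (Z s - Z
    t)^(2m) is bounded by a constant times |s - t|^m, and the choice m > 4 n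
    beats the number of cells of the grids of mesh 16^-k. Outside one null
    set, the values of Z along the grid approximations of t then converge for
    all t of T at once. The modification is their limit, except at the grid
    representatives, where Z is kept; these representatives form a countable
    separant, since the modification is a limit of its own values on them.

    The set T may be very irregular, as the ranges of the a_i are; the grid
    representatives are therefore chosen inside T, in every cell that meets T. *)

(** * Moments of Gaussian laws *)

(** The density is the Radon-Nikodym derivative almost everywhere, which
    reduces the claim to the change of variables for that derivative. *)
Lemma ge0_integral_normal_prob {R : realType} (m s : R) (f : R -> \bar R) :
  measurable_fun [set: R] f -> (forall x, (0 <= f x)%E) ->
  (\int[normal_prob m s]_x f x =
   \int[lebesgue_measure]_x (f x * (normal_pdf m s x)%:E))%E.
Proof.
move=> mf f0.
have dom := normal_prob_dominates m s.
rewrite -(Radon_Nikodym_SigmaFinite.change_of_variables dom)//.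
set g := Radon_Nikodym_SigmaFinite.f _ _.
have ig : lebesgue_measure.-integrable setT g.
  exact: Radon_Nikodym_SigmaFinite.f_integrable.
have mg : measurable_fun setT g by exact: measurable_int ig.
have mpdf : measurable_fun setT (fun x => (normal_pdf m s x)%:E).
  by apply/measurable_EFinP; exact: measurable_normal_pdf.
apply: ae_eq_integral => //; try exact: emeasurable_funM.
apply: ae_eqe_mul2l.
apply: integral_ae_eq => // E _ mE.
by rewrite -Radon_Nikodym_SigmaFinite.f_integral.
Qed.

Lemma expR_ge_exprn_fact {R : realType} (k : nat) (y : R) :
  0 <= y -> y ^+ k <= k`!%:R * expR y.
Proof.
move=> y0; case: k => [|k].
  by rewrite expr0 fact0 mul1r -expR0 ler_expR.
have := expR_ge1Dxn k y0; rewrite addrC -lerBrDr => H.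
rewrite mulrC -ler_pdivrMr ?ltr0n ?fact_gt0//.
by apply: le_trans H _; rewrite gerBl.
Qed.

(** Half of the Gaussian exponent absorbs the power, because y ^ k <= k! exp y
    for y = (x - m)^2 / (4 s^2); the other half is the exponent of the density
    with variance 2 s^2, whose integral is 1. This replaces the computation of
    the moments by a domination. *)
Lemma normal_moment_pdf_le {R : realType} (m s : R) k x : 0 < s ->
  (x - m) ^+ k.*2 * normal_pdf m s x <=
  k`!%:R * 4 ^+ k * s ^+ k.*2 * Num.sqrt 2 * normal_pdf m (Num.sqrt 2 * s) x.
Proof.
move=> s0.
have r0 : (0 : R) < Num.sqrt 2 by rewrite sqrtr_gt0.
have r2 : Num.sqrt 2 ^+ 2 = 2 :> R by rewrite sqr_sqrtr.
rewrite !normal_pdfE ?gt_eqF ?mulr_gt0//.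
set y := (x - m) ^+ 2 / (4 * s ^+ 2).
have y0 : 0 <= y by rewrite divr_ge0 ?sqr_ge0// mulr_ge0// sqr_ge0.
have sn0 : s != 0 by rewrite gt_eqF.
have -> : normal_fun m s x = expR (- y) * expR (- y).
  by rewrite -expRD; congr expR; rewrite /y; field.
have -> : normal_fun m (Num.sqrt 2 * s) x = expR (- y).
  by rewrite /normal_fun exprMn r2; congr expR; rewrite /y; field.
have -> : (x - m) ^+ k.*2 = 4 ^+ k * s ^+ k.*2 * y ^+ k.
  rewrite -!muln2 !(mulnC k) !exprM -!exprMn; congr (_ ^+ k); rewrite /y; field.
  done.
have -> : normal_peak s = Num.sqrt 2 * normal_peak (Num.sqrt 2 * s).
  rewrite /normal_peak exprMn r2.
  have -> : 2 * s ^+ 2 * pi *+ 2 = 2 * (s ^+ 2 * pi *+ 2).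
    by rewrite -mulr_natr; ring.
  by rewrite sqrtrM// invfM mulVKf ?gt_eqF.
set p := normal_peak _; have p0 : 0 <= p by exact: normal_peak_ge0.
set e := expR (- y).
have H : y ^+ k * e <= k`!%:R.
  have /(ler_wpM2r (expR_ge0 (- y))) := expR_ge_exprn_fact k y y0.
  by rewrite -mulrA -expRD subrr expR0 mulr1.
have -> : 4 ^+ k * s ^+ k.*2 * y ^+ k * (Num.sqrt 2 * p * (e * e)) =
  (y ^+ k * e) * (4 ^+ k * s ^+ k.*2 * Num.sqrt 2 * p * e) by ring.
have -> : k`!%:R * 4 ^+ k * s ^+ k.*2 * Num.sqrt 2 * (p * e) =
  k`!%:R * (4 ^+ k * s ^+ k.*2 * Num.sqrt 2 * p * e) by ring.
apply: ler_wpM2r => //.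
by rewrite !mulr_ge0 ?expR_ge0 ?exprn_ge0// ltW.
Qed.

Lemma normal_central_moment_le {R : realType} (m s : R) k : 0 < s ->
  (\int[normal_prob m s]_x ((x - m) ^+ k.*2)%:E <=
   (k`!%:R * 4 ^+ k * Num.sqrt 2 * s ^+ k.*2)%:E)%E.
Proof.
move=> s0; rewrite ge0_integral_normal_prob; last 2 first.
- apply/measurable_EFinP; apply: measurable_funX; exact: measurable_funB.
- by move=> x; rewrite lee_fin exprn_even_ge0// odd_double.
have C0 : 0 <= k`!%:R * 4 ^+ k * s ^+ k.*2 * Num.sqrt 2 :> R.
  by rewrite !mulr_ge0 ?exprn_ge0// ltW.
apply: (@le_trans _ _ (\int[lebesgue_measure]_x
    ((k`!%:R * 4 ^+ k * s ^+ k.*2 * Num.sqrt 2)%:E *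
     (normal_pdf m (Num.sqrt 2 * s) x)%:E))%E).
  apply: ge0_le_integral => //.
  - move=> x _; rewrite -EFinM lee_fin mulr_ge0 ?normal_pdf_ge0//.
    by rewrite exprn_even_ge0// odd_double.
  - apply/measurable_EFinP; apply: measurable_funM.
      apply: measurable_funX; exact: measurable_funB.
    exact: measurable_normal_pdf.
  - apply/measurable_EFinP; apply: measurable_funM => //.
    exact: measurable_normal_pdf.
  - by move=> x _; rewrite -!EFinM lee_fin normal_moment_pdf_le.
rewrite ge0_integralZl//; last 2 first.
- by apply/measurable_EFinP; exact: measurable_normal_pdf.
- by move=> x _; rewrite lee_fin normal_pdf_ge0.
by rewrite integral_normal_pdf mule1 lee_fin -!mulrA (mulrC (s ^+ _)).
Qed.

(** The density is at most 1 / (s \sqrt(2 pi)) <= 1 / (2 s), so the interval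
    [- s / 2, s / 2] has probability at most 1 / 2, whatever the mean; outside
    of it x^2 >= s^2 / 4. *)
Lemma normal_second_moment_ge {R : realType} (m s : R) : 0 < s ->
  ((s ^+ 2 / 8)%:E <= \int[normal_prob m s]_x (x ^+ 2)%:E)%E.
Proof.
move=> s0; set J := (X in (_ <= X)%E).
pose I : set R := `[- (s / 2), s / 2]%classic.
have mI : measurable I by exact: measurable_itv.
have PI : (normal_prob m s I <= 2^-1%:E)%E.
  rewrite /normal_prob.
  apply: (@le_trans _ _ (\int[lebesgue_measure]_(x in I) (normal_peak s)%:E)%E).
    apply: ge0_le_integral => //.
    - by move=> x _; rewrite lee_fin normal_pdf_ge0.
    - by apply/measurable_EFinP/measurable_funTS; exact: measurable_normal_pdf.
    - by move=> x _; rewrite lee_fin normal_pdf_ub// gt_eqF.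
  rewrite integral_cst//= lebesgue_measure_itv/= lte_fin.
  case: ifPn => [_|]; last by rewrite mule0 lee_fin invr_ge0.
  rewrite -EFinB -EFinM lee_fin opprK -splitr /normal_peak mulrC.
  rewrite ler_pdivrMr; last first.
    by rewrite sqrtr_gt0 mulrn_wgt0// mulr_gt0 ?pi_gt0// exprn_gt0.
  rewrite -ler_pdivrMl ?invr_gt0// invrK -[leLHS]ger0_norm; last first.
    by rewrite mulr_ge0// ltW.
  rewrite -sqrtr_sqr ler_sqrt; last first.
    by rewrite mulrn_wge0// mulr_ge0 ?pi_ge0// sqr_ge0.
  rewrite exprMn.
  have := pi_ge2 R; have : 0 < s ^+ 2 by rewrite exprn_gt0.
  move: (s ^+ 2) (pi) => u v u0 v0.
  rewrite -[leRHS]mulr_natr; nra.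
have step : ((s ^+ 2 / 4)%:E <= J + (s ^+ 2 / 8)%:E)%E.
  have -> : (s ^+ 2 / 4)%:E = (\int[normal_prob m s]_x (s ^+ 2 / 4)%:E)%E.
    by rewrite integral_cst// [X in (_ * X)%E]probability_setT mule1.
  apply: (@le_trans _ _ (\int[normal_prob m s]_x
      ((x ^+ 2)%:E + (s ^+ 2 / 4)%:E * (\1_I x)%:E))%E).
    apply: ge0_le_integral => //.
    - by move=> x _; rewrite lee_fin divr_ge0 ?sqr_ge0.
    - apply: emeasurable_funD.
        by apply/measurable_EFinP; exact: measurable_funX.
      by apply/measurable_EFinP; apply: measurable_funM.
    - move=> x _; rewrite -EFinM -EFinD lee_fin indicE.
      case: (boolP (x \in I)) => [_|].
        by rewrite mulr1 lerDr sqr_ge0.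
      rewrite notin_setE /I/= in_itv/= => /negP.
      rewrite mulr0 addr0 -ler_norml -ltNge => H.
      rewrite -[leRHS]real_normK ?num_real//.
      rewrite (_ : _ / 4 = (s / 2) ^+ 2); last by field.
      by rewrite lerXn2r ?nnegrE ?normr_ge0 ?divr_ge0// ltW.
  rewrite ge0_integralD//; last 4 first.
  - by move=> x _; rewrite lee_fin sqr_ge0.
  - by apply/measurable_EFinP; exact: measurable_funX.
  - by move=> x _; rewrite -EFinM lee_fin mulr_ge0 ?divr_ge0 ?sqr_ge0.
  - by apply/measurable_EFinP; apply: measurable_funM.
  rewrite leeD2l// ge0_integralZl//; last 2 first.
  - by apply/measurable_EFinP; exact: measurable_indic.
  - by rewrite lee_fin divr_ge0 ?sqr_ge0.
  rewrite integral_indic// setIT.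
  apply: (@le_trans _ _ ((s ^+ 2 / 4)%:E * 2^-1%:E)%E).
    by rewrite lee_pmul2l// ?lte_fin ?divr_gt0 ?exprn_gt0.
  by rewrite -EFinM lee_fin; have := sqr_ge0 s; lra.
move: step; rewrite -leeBlDr//; apply: le_trans.
by rewrite -EFinB lee_fin; have := sqr_ge0 s; lra.
Qed.

Lemma exprD_le2X {R : realType} (a b : R) k :
  (a + b) ^+ k.*2 <= 4 ^+ k * (a ^+ k.*2 + b ^+ k.*2).
Proof.
rewrite -!muln2 !(mulnC k) !exprM (_ : 4 = 2 ^+ 2 :> R); last by rewrite -natrX.
wlog ab : a b / `|a| <= `|b|.
  move=> H; have /orP[/H//|/H] := le_total `|a| `|b|.
  by rewrite addrC (addrC (_ ^+ _)).
have H : (a + b) ^+ 2 <= 2 ^+ 2 * b ^+ 2.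
  rewrite -exprMn -real_normK ?num_real// -[leRHS]real_normK ?num_real//.
  rewrite lerXn2r ?nnegrE// (le_trans (ler_normD _ _))//.
  rewrite normrM (gtr0_norm (ltr0n _ 2)).
  have := ab; lra.
apply: (@le_trans _ _ ((2 ^+ 2 * b ^+ 2) ^+ k)).
  by apply: lerXn2r; rewrite ?nnegrE ?sqr_ge0// mulr_ge0 ?sqr_ge0.
rewrite [leLHS]exprMn ler_pM2l ?exprn_gt0// lerDr exprn_ge0// sqr_ge0//.
Qed.

(** Both parameters of a normal law are controlled by its second moment v: s^2
    by [normal_second_moment_ge], then m^2 by m^2 <= 2 (x - m)^2 + 2 x^2. The
    centered moments then give the others. *)
Lemma normal_moment_le (R : realType) k : exists2 C : R, 0 <= C &
  forall m s v, 0 < s ->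
    (\int[normal_prob m s]_x (x ^+ 2)%:E <= v%:E)%E ->
    (\int[normal_prob m s]_x (x ^+ k.*2)%:E <= (C * v ^+ k)%:E)%E.
Proof.
(* s^2 <= 8 v and m^2 <= 130 v below are where 8 and 130 come from. *)
exists (4 ^+ k * (k`!%:R * 4 ^+ k * 2 * 8 ^+ k + 130 ^+ k)).
  by rewrite mulr_ge0 ?addr_ge0 ?mulr_ge0 ?exprn_ge0.
move=> m s v s0 Hv.
have r2 : Num.sqrt 2 <= 2 :> R.
  by rewrite -[leRHS]ger0_norm// -sqrtr_sqr ler_sqrt// expr2; lra.
have mX (a : R) n : measurable_fun setT (fun x : R => ((x - a) ^+ n)%:E).
  by apply/measurable_EFinP; apply: measurable_funX; exact: measurable_funB.
have mX0 n : measurable_fun setT (fun x : R => (x ^+ n)%:E).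
  by apply/measurable_EFinP; exact: measurable_funX.
have Icst (r : R) : (\int[normal_prob m s]_x r%:E = r%:E)%E.
  by rewrite integral_cst// [X in (_ * X)%E]probability_setT mule1.
have s8v : s ^+ 2 <= 8 * v.
  have := le_trans (normal_second_moment_ge m s s0) Hv.
  by rewrite lee_fin; lra.
have v0 : 0 <= v by have := sqr_ge0 s; lra.
have m2v : m ^+ 2 <= 130 * v.
  rewrite -lee_fin -Icst.
  apply: (@le_trans _ _ (\int[normal_prob m s]_x
      (2%:E * ((x - m) ^+ 2)%:E + 2%:E * (x ^+ 2)%:E))%E).
    apply: ge0_le_integral => //.
    - by move=> x _; rewrite lee_fin sqr_ge0.
    - apply: emeasurable_funD; apply: measurable_funeM.
        exact: mX.
      exact: mX0.
    - move=> x _; rewrite -!EFinM -EFinD lee_fin.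
      by have := sqr_ge0 (2 * x - m); nra.
  rewrite ge0_integralD//; last 4 first.
  - by move=> x _; rewrite -EFinM lee_fin mulr_ge0 ?sqr_ge0.
  - by apply: measurable_funeM; exact: mX.
  - by move=> x _; rewrite -EFinM lee_fin mulr_ge0 ?sqr_ge0.
  - by apply: measurable_funeM; exact: mX0.
  rewrite !ge0_integralZl//; try by move=> x _; rewrite lee_fin sqr_ge0.
  all: try exact: mX; try exact: mX0.
  apply: (@le_trans _ _ (2%:E * (4 * 2 * s ^+ 2)%:E + 2%:E * v%:E)%E).
    rewrite leeD// lee_pmul2l//.
    apply: (le_trans (normal_central_moment_le m s 1 s0)).
    rewrite lee_fin -[1`!]/1%N mul1r expr1 ler_wpM2r ?sqr_ge0//.
    by rewrite ler_pM2l.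
  by rewrite -!EFinM -EFinD lee_fin; lra.
apply: (@le_trans _ _ (\int[normal_prob m s]_x
    ((4 ^+ k)%:E * (((x - m) ^+ k.*2)%:E + (m ^+ k.*2)%:E)))%E).
  apply: ge0_le_integral => //.
  - by move=> x _; rewrite lee_fin exprn_even_ge0// odd_double.
  - exact: mX0.
  - apply: measurable_funeM.
    by apply: emeasurable_funD; [exact: mX|exact: measurable_cst].
  - move=> x _; rewrite -EFinD -EFinM lee_fin.
    by have := exprD_le2X (x - m) m k; rewrite subrK.
rewrite ge0_integralZl//; last 2 first.
- by apply: emeasurable_funD; [exact: mX|exact: measurable_cst].
- by move=> x _; rewrite adde_ge0// lee_fin exprn_even_ge0// odd_double.
rewrite ge0_integralD//; last 3 first.
- by move=> x _; rewrite lee_fin exprn_even_ge0// odd_double.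
- exact: mX.
- by move=> x _; rewrite lee_fin exprn_even_ge0// odd_double.
rewrite Icst -mulrA EFinM lee_pmul2l ?lte_fin ?exprn_gt0//.
rewrite mulrDl EFinD leeD//.
  apply: (le_trans (normal_central_moment_le m s k s0)).
  rewrite lee_fin -[leRHS]mulrA; apply: ler_pM.
  - by rewrite !mulr_ge0 ?exprn_ge0.
  - by rewrite exprn_ge0// ltW.
  - by rewrite ler_pM2l// mulr_gt0 ?exprn_gt0// ltr0n fact_gt0.
  rewrite -muln2 mulnC exprM -exprMn.
  by apply: lerXn2r; rewrite ?nnegrE ?sqr_ge0// mulr_ge0.
rewrite lee_fin -muln2 mulnC exprM -exprMn.
by apply: lerXn2r; rewrite ?nnegrE ?sqr_ge0// mulr_ge0.
Qed.

(** The constant depends on k only, not on the variable: this is what makes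
    second moments of increments sufficient for chaining. *)
Lemma gaussian_moment_le (R : realType) k : exists2 C : R, 0 <= C &
  forall d (Omega : measurableType d) (P : probability Omega R)
    (W : {RV P >-> R}) v,
    gaussian_law (pushforward P W) ->
    (\int[P]_w (W w ^+ 2)%:E <= v%:E)%E ->
    (\int[P]_w (W w ^+ k.*2)%:E <= (C * v ^+ k)%:E)%E.
Proof.
have [C C0 HC] := normal_moment_le R k.
exists (C + 1); first by rewrite addr_ge0.
move=> d Omega P W v gW.
have E n : ~~ odd n -> (\int[P]_w (W w ^+ n)%:E =
    \int[distribution P W]_x (x ^+ n)%:E)%E.
  move=> en; rewrite (ge0_integral_distribution W (f := fun x => (x ^+ n)%:E))//.
    by apply/measurable_EFinP; exact: measurable_funX.
  by move=> y; rewrite lee_fin exprn_even_ge0.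
rewrite !E ?odd_double//.
case: gW => [[m Hm]|[m [s [s0 Hs]]]].
- have Ed n : ~~ odd n -> (\int[distribution P W]_x (x ^+ n)%:E = (m ^+ n)%:E)%E.
    move=> en.
    have -> : (\int[distribution P W]_x (x ^+ n)%:E = \int[\d_m]_x (x ^+ n)%:E)%E.
      by apply: eq_measure_integral => A mA _; exact: Hm.
    rewrite integral_dirac ?diracT ?mul1e//.
    by apply/measurable_EFinP; exact: measurable_funX.
  rewrite !Ed ?odd_double// !lee_fin => mv.
  have v0 : 0 <= v by apply: le_trans mv; exact: sqr_ge0.
  rewrite -muln2 mulnC exprM; apply: (@le_trans _ _ (v ^+ k)).
    by apply: lerXn2r; rewrite ?nnegrE ?sqr_ge0.
  by rewrite ler_peMl ?exprn_ge0// lerDr.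
- have Ed n : ~~ odd n -> (\int[distribution P W]_x (x ^+ n)%:E =
      \int[normal_prob m s]_x (x ^+ n)%:E)%E.
    (* The normal law lives on the same sigma-algebra of R presented as a
       generated one; the identity map transports the integral. *)
    move=> en; pose id' : measurableTypeR R -> R := id.
    have mid : measurable_fun [set: measurableTypeR R] id' by exact: measurable_id.
    transitivity (\int[pushforward (normal_prob m s) id']_x (x ^+ n)%:E)%E.
      by apply: eq_measure_integral => A mA _; exact: Hs.
    rewrite ge0_integral_pushforward//.
    - by apply/measurable_EFinP; exact: measurable_funX.
    - by move=> x _; rewrite lee_fin exprn_even_ge0.
  rewrite !Ed ?odd_double// => Hv; apply: (le_trans (HC _ _ _ s0 Hv)).
  have v0 : 0 <= v.
    rewrite -lee_fin; apply: le_trans Hv; apply: integral_ge0 => x _.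
    by rewrite lee_fin sqr_ge0.
  by rewrite lee_fin ler_wpM2r ?exprn_ge0// lerDl.
Qed.

(** * Almost sure convergence of series *)

(** The sum of the series has a finite integral, so it is finite almost
    everywhere. *)
Lemma ae_cvg_series_geometric {R : realType} {d} {T : measurableType d}
    (mu : {measure set T -> \bar R}) (f : nat -> T -> R) (a z : R) :
  (forall k, measurable_fun [set: T] (f k)) -> (forall k x, 0 <= f k x) ->
  0 <= a -> 0 <= z < 1 ->
  (forall k, (\int[mu]_x (f k x)%:E <= (geometric a z k)%:E)%E) ->
  {ae mu, forall x, cvgn (series (f ^~ x))}.
Proof.
move=> mf f0 a0 /andP[z0 z1] Hf.
have mF k : measurable_fun [set: T] (fun x => (f k x)%:E) by exact/measurable_EFinP.
have F0 k x : [set: T] x -> (0 <= (f k x)%:E)%E by rewrite lee_fin.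
pose S x := (\sum_(k <oo) (f k x)%:E)%E.
have S0 x : (0 <= S x)%E by apply: nneseries_ge0 => k _ _; rewrite lee_fin.
have iS : mu.-integrable [set: T] S.
  apply/integrableP; split.
    by apply: ge0_emeasurable_sum => // k x _ _; rewrite lee_fin.
  under eq_integral do rewrite gee0_abs//.
  rewrite integral_nneseries//.
  apply: (@le_lt_trans _ _ (\sum_(k <oo) (geometric a z k)%:E)%E).
    apply: lee_nneseries => [k _ _|k _]; last exact: Hf.
    by apply: integral_ge0 => x _; rewrite lee_fin.
  have cg : cvgn (series (geometric a z)).
    by apply: is_cvg_geometric_series; rewrite ger0_norm.
  rewrite (_ : (fun n => _) = EFin \o series (geometric a z)); last first.
    by apply/funext => n /=; rewrite sumEFin.
  by rewrite EFin_lim// ltry.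
have := integrable_ae measurableT iS.
apply: filterS => x /(_ I) Sfin.
apply: nnseries_is_cvg; first by move=> i.
by rewrite ltey_eq Sfin.
Qed.

Lemma is_cvg_dominated_increments {R : realType} (u v : R^nat) :
  (forall k, `|u k.+1 - u k| <= v k) -> cvgn (series v) -> cvgn u.
Proof.
move=> uv cv.
have ct : cvgn (series (telescope u)).
  apply: normed_cvg; apply: (series_le_cvg _ _ _ cv) => k //=; last exact: uv.
  exact: le_trans (normr_ge0 _) (uv k).
rewrite (_ : u = fun k => u 0%N + series (telescope u) k); last first.
  by apply/funext => i; exact: eq_sum_telescope.
by apply: is_cvgD => //; exact: is_cvg_cst.
Qed.

(** * Grids adapted to a subset of the unit cube *)

Section grid.
Context {R : realType} {n : nat}.
Implicit Types (T : set 'rV[R]_n) (s t : 'rV[R]_n).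

(** Cells of mesh 16^-k; each coordinate takes the extra index 16^k, reached
    by the points with a coordinate equal to 1. *)
Definition grid_index k : finType := {ffun 'I_n -> 'I_(16 ^ k).+1}.

Definition grid_cell k t : grid_index k :=
  [ffun i => inord (Num.truncn (16 ^+ k * t 0 i))].

Lemma norm_rV_le t (e : R) : 0 <= e -> (forall i, `|t 0 i| <= e) -> `|t| <= e.
Proof.
move=> e0 H; rewrite [`|t|]mx_normrE; apply/bigmax_leP; split => // -[i j] _ /=.
by rewrite ord1.
Qed.

Lemma coord_le_norm_rV t i : `|t 0 i| <= `|t|.
Proof.
by rewrite [leRHS]mx_normrE (le_bigmax _ (fun ij => `|t ij.1 ij.2|) (0, i)).
Qed.

Lemma grid_cell_dist k s t : unit_cube s -> unit_cube t ->
  grid_cell k s = grid_cell k t -> `|s - t| <= (16 ^+ k)^-1.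
Proof.
move=> Ks Kt st; apply: norm_rV_le => [|i]; first by rewrite invr_ge0 exprn_ge0.
have k0 : 0 < 16 ^+ k :> R by rewrite exprn_gt0.
have bd (x : 'rV[R]_n) : unit_cube x -> let y := 16 ^+ k * x 0 i in
    0 <= y /\ (Num.truncn y < (16 ^ k).+1)%N.
  move=> Kx; have /andP[x0 x1] := Kx i; split; first by rewrite mulr_ge0// ltW.
  rewrite ltnS truncn_le_nat -(natr1 (16 ^ k)) natrX (@le_lt_trans _ _ (16 ^+ k))//.
    by rewrite -[leRHS]mulr1 ler_pM2l.
  by rewrite ltrDl.
have [[s0 sk] [t0 tk]] := (bd s Ks, bd t Kt).
have : Num.truncn (16 ^+ k * s 0 i) = Num.truncn (16 ^+ k * t 0 i).
  have /(congr1 (fun f : grid_index k => f i)) := st.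
  by rewrite !ffunE => /(congr1 val)/=; rewrite !inordK.
have /andP[sl su] := truncn_itv s0; have /andP[tl tu] := truncn_itv t0.
move=> E; rewrite E in sl su.
rewrite !mxE -(ler_pM2l k0) mulfV ?gt_eqF//.
rewrite -[X in X * _ <= _](gtr0_norm k0) -normrM.
move: sl su tl tu; rewrite mulrBr -(natr1 (Num.truncn _)).
move: (16 ^+ k * t 0 i) (16 ^+ k * s 0 i) => x y; move: (_%:R) => z *.
by rewrite ler_norml; apply/andP; split; lra.
Qed.

(** The default value 0, taken on the cells that miss T, need not be in T. *)
Definition grid_rep T k (c : grid_index k) : 'rV[R]_n :=
  xget 0 [set t | T t /\ grid_cell k t = c].

Definition grid_approx T k t := grid_rep T k (grid_cell k t).

Definition grid_points T := [set grid_approx T k t | k in [set: nat] & t in T].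

Lemma grid_repP T k t : T t ->
  T (grid_approx T k t) /\ grid_cell k (grid_approx T k t) = grid_cell k t.
Proof. by move=> Tt; apply: (@xgetPex _ 0 [set x | T x /\ _]); exists t. Qed.

Lemma grid_approx_dist T k t : T `<=` unit_cube -> T t ->
  `|t - grid_approx T k t| <= (16 ^+ k)^-1.
Proof.
move=> TK Tt; have [Ta ct] := grid_repP T k t Tt.
by apply: grid_cell_dist; [exact: TK|exact: TK|rewrite ct].
Qed.

Lemma cvg_grid_approx T t : T `<=` unit_cube -> T t ->
  grid_approx T ^~ t @ \oo --> t.
Proof.
move=> TK Tt; apply/cvgrPdist_le => e e0.
have H : (fun k => (16 ^+ k)^-1 : R) @ \oo --> 0.
  under eq_cvg do rewrite -exprVn.
  by apply: cvg_expr; rewrite ger0_norm ?invf_lt1// ltr1n.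
move/cvgrPdist_le : H => /(_ e e0).
apply: filterS => k; rewrite sub0r normrN ger0_norm ?invr_ge0 ?exprn_ge0//.
exact/le_trans/grid_approx_dist.
Qed.

Lemma countable_grid_points T : countable (grid_points T).
Proof.
apply: (@sub_countable _ _ _ (\bigcup_k range (grid_rep T k))).
  apply: subset_card_le => _ [k _ [t Tt <-]].
  by exists k => //; exists (grid_cell k t).
apply: bigcup_countable => // k _; apply: finite_set_countable.
exact: finite_image.
Qed.

Lemma grid_points_sub T : grid_points T `<=` T.
Proof. by move=> _ [k _ [t Tt <-]]; have [] := grid_repP T k t Tt. Qed.

Lemma grid_points_dense T : T `<=` unit_cube -> T `<=` closure (grid_points T).
Proof.
move=> TK t Tt.
apply: (@closed_cvg _ _ \oo _ (grid_approx T ^~ t)) (cvg_grid_approx T t TK Tt).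
  exact: closed_closure.
by apply: nearW => k; apply: subset_closure; exists k => //; exists t.
Qed.

Lemma card_grid_index k : #|grid_index k| = ((16 ^ k).+1 ^ n)%N.
Proof. by rewrite card_ffun !card_ord. Qed.

End grid.

(** * Separable modifications by chaining *)

(** Either the scaled value y = 2^k x has norm at most 1, or |y| <= y^(2m).
    The bound trades the norm, whose sum over a grid is too large, for a power
    of high order plus a summable constant. *)
Lemma ler_norm_dyadic {R : realFieldType} (m k : nat) (x : R) : (0 < m)%N ->
  `|x| <= 2^-1 ^+ k + (2 ^+ k * x) ^+ m.*2.
Proof.
move=> m0; have k1 : 1 <= 2 ^+ k :> R by rewrite exprn_ege1// ler1n.
have k0 : 0 < 2 ^+ k :> R by exact: lt_le_trans k1.
set y := 2 ^+ k * x.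
have yE : `|y| = 2 ^+ k * `|x| by rewrite /y normrM gtr0_norm.
have yX : y ^+ m.*2 = `|y| ^+ m.*2.
  by rewrite -[RHS]normrX ger0_norm// exprn_even_ge0// odd_double.
rewrite exprVn; have [y1|y1] := leP `|y| 1.
  apply: (@le_trans _ _ (2 ^+ k)^-1); last by rewrite lerDl yX exprn_ge0.
  by rewrite -(ler_pM2l k0) mulfV ?gt_eqF// -yE.
apply: (@le_trans _ _ (y ^+ m.*2)); last by rewrite lerDr invr_ge0 ltW.
apply: (@le_trans _ _ `|y|); first by rewrite yE ler_peMl.
by rewrite yX ler_eXnr// ?double_gt0// ltW.
Qed.

(** Kolmogorov's condition on the increments, with an exponent of |s - t| that
    is large enough for grids of mesh 16^-k: summing over the (at most 64^n
    256^(nk)) pairs of nearby cells the moments of order 2m of 2^k times the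
    increments leaves the ratio 256^n / 4^m < 1. *)
Section kolmogorov.
Context {R : realType} {d : measure_display} {Omega : measurableType d}.
Context (P : probability Omega R) {n : nat} (T : set 'rV[R]_n).
Context (Z : 'rV[R]_n -> {RV P >-> R}) (m : nat) (C : R).
Hypothesis T_cube : T `<=` unit_cube.
Hypothesis m_gt : (4 * n < m)%N.
Hypothesis C_ge0 : 0 <= C.
Hypothesis Z_moment : forall s t, T s -> T t ->
  (\int[P]_w ((Z s w - Z t w) ^+ m.*2)%:E <= (C * `|s - t| ^+ m)%:E)%E.

Let m_gt0 : (0 < m)%N. Proof. exact: leq_ltn_trans m_gt. Qed.

Let incr (c : R) s t w := (c * (Z s w - Z t w)) ^+ m.*2.

Let measurable_incr c s t : measurable_fun [set: Omega] (incr c s t).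
Proof.
apply: measurable_funX; apply: measurable_funM => //.
by apply: measurable_funB; exact: measurable_funP.
Qed.

Let incr_ge0 c s t w : 0 <= incr c s t w.
Proof. by rewrite exprn_even_ge0// odd_double. Qed.

(** Scaling the increments by 2^k costs (2^k)^(2m) = 4^(mk), while a distance
    of order 16^-k gains 16^(-mk): the factor 4^(-mk) is left. *)
Let integral_incr_le k s t e : T s -> T t -> `|s - t| <= e * (16 ^+ k)^-1 ->
  (\int[P]_w (incr (2 ^+ k) s t w)%:E <= (C * e ^+ m * ((4 ^+ m)^-1) ^+ k)%:E)%E.
Proof.
move=> Ts Tt st.
have -> : (\int[P]_w (incr (2 ^+ k) s t w)%:E =
    ((2 ^+ k) ^+ m.*2)%:E * \int[P]_w ((Z s w - Z t w) ^+ m.*2)%:E)%E.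
  rewrite -ge0_integralZl//.
  - by apply: eq_integral => w _; rewrite /incr exprMn EFinM.
  - apply/measurable_EFinP; apply: measurable_funX.
    by apply: measurable_funB; exact: measurable_funP.
  - by move=> w _; rewrite lee_fin exprn_even_ge0// odd_double.
have c0 : (0 <= ((2 ^+ k) ^+ m.*2 : R)%:E)%E by rewrite lee_fin !exprn_ge0.
apply: (le_trans (lee_wpmul2l c0 (Z_moment s t Ts Tt))).
rewrite -EFinM lee_fin.
have -> : (2 ^+ k) ^+ m.*2 = 4 ^+ m ^+ k :> R.
  rewrite -muln2 mulnC exprM -(exprM 2) mulnC (exprM 2) -exprM mulnC exprM.
  by congr (_ ^+ _ ^+ _); rewrite expr2; lra.
have H : `|s - t| ^+ m <= e ^+ m * (16 ^+ m)^-1 ^+ k.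
  apply: le_trans (_ : (e * (16 ^+ k)^-1) ^+ m <= _); last first.
    by rewrite exprMn !exprVn -!exprM mulnC.
  by apply: lerXn2r => //; rewrite nnegrE ?normr_ge0// (le_trans _ st).
apply: (@le_trans _ _ (4 ^+ m ^+ k * (C * (e ^+ m * (16 ^+ m)^-1 ^+ k)))).
  by rewrite ler_wpM2l ?exprn_ge0// ler_wpM2l.
have -> : (16 ^+ m)^-1 = (4 ^+ m)^-1 * (4 ^+ m)^-1 :> R.
  by rewrite -invfM -exprMn; congr ((_ ^+ _)^-1); lra.
have xy : 4 ^+ m ^+ k * (4 ^+ m)^-1 ^+ k = 1 :> R.
  by rewrite -exprMn mulfV ?expr1n// expf_neq0.
rewrite exprMn; move: xy; move: (4 ^+ m ^+ k) ((4 ^+ m)^-1 ^+ k) => x y xy.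
rewrite [leLHS](_ : _ = C * e ^+ m * y * (x * y)); last by ring.
by rewrite xy mulr1.
Qed.

(** The pairs of cells, of two consecutive levels, that share a point of T.
    Their representatives are at distance at most 2 / 16^k, and every point of
    T yields such a pair. *)
Let meeting_cells k : seq (grid_index (n := n) k.+1 * grid_index (n := n) k) :=
  [seq p <- enum {: grid_index (n := n) k.+1 * grid_index (n := n) k} |
   `[< exists2 t, T t & p = (grid_cell k.+1 t, grid_cell k t) >]].

Let size_meeting_cells k :
  (size (meeting_cells k))%:R <= 64 ^+ n * (256 ^+ n) ^+ k :> R.
Proof.
have H j : (16 ^ j).+1%:R <= 2 * 16 ^+ j :> R.
  rewrite -(natr1 (16 ^ j)) natrX mulrDl mul1r lerD2l.
  by rewrite exprn_ege1// ler1n.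
apply: (@le_trans _ _
  (#|{: grid_index (n := n) k.+1 * grid_index (n := n) k}|%:R)).
  by rewrite ler_nat cardT size_filter count_size.
rewrite card_prod !card_grid_index natrM !natrX.
apply: (@le_trans _ _ ((2 * 16 ^+ k.+1) ^+ n * (2 * 16 ^+ k) ^+ n)).
  by apply: ler_pM; rewrite ?exprn_ge0//; apply: lerXn2r;
    rewrite ?nnegrE ?mulr_ge0 ?exprn_ge0.
rewrite -exprMn -exprM mulnC exprM -exprMn.
have -> : 2 * 16 ^+ k.+1 * (2 * 16 ^+ k) = 64 * 256 ^+ k :> R.
  rewrite exprS (_ : 256 = 16 * 16) ?exprMn; last by lra.
  by ring.
by [].
Qed.

(** The exceptional set is the same for all t: the increment between two
    levels is one term of a sum over finitely many cells, and these sums,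
    which do not depend on t, form an almost surely convergent series. *)
Lemma ae_cvg_along_grid :
  {ae P, forall w, forall t, T t -> cvgn (fun k => Z (grid_approx T k t) w)}.
Proof.
pose f k w := \sum_(p <- meeting_cells k)
  incr (2 ^+ k) (grid_rep T k.+1 p.1) (grid_rep T k p.2) w.
have f0 k w : 0 <= f k w by apply: sumr_ge0.
have mf k : measurable_fun [set: Omega] (f k) by apply: measurable_sum.
pose a := C * 2 ^+ m * 64 ^+ n; pose z : R := 256 ^+ n / 4 ^+ m.
have z1 : 0 <= z < 1.
  apply/andP; split; first by rewrite divr_ge0 ?exprn_ge0.
  rewrite ltr_pdivrMr ?exprn_gt0// mul1r (_ : 256 = 4 ^+ 4).
    by rewrite -exprM ltr_eXn2l// ltr1n.
  by rewrite -natrX.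
have intf k : (\int[P]_w (f k w)%:E <= (geometric a z k)%:E)%E.
  have -> : (\int[P]_w (f k w)%:E = \sum_(p <- meeting_cells k) \int[P]_w
      (incr (2 ^+ k) (grid_rep T k.+1 p.1) (grid_rep T k p.2) w)%:E)%E.
    rewrite -ge0_integral_sum//.
    - by apply: eq_integral => w _; rewrite -sumEFin.
    - by move=> p; exact/measurable_EFinP.
    - by move=> p w _; rewrite lee_fin.
  apply: (@le_trans _ _ (\sum_(p <- meeting_cells k)
      (C * 2 ^+ m * ((4 ^+ m)^-1) ^+ k)%:E)%E).
    rewrite big_seq [leRHS]big_seq; apply: lee_sum => p.
    rewrite mem_filter => /andP[/asboolP[t Tt ->] _] /=.
    have [[T1 _] [T2 _]] := (grid_repP T k.+1 t Tt, grid_repP T k t Tt).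
    apply: integral_incr_le => //.
    apply: (le_trans (ler_distD t _ _)).
    rewrite mulrDl mul1r distrC lerD//; last exact: grid_approx_dist.
    apply: (le_trans (grid_approx_dist T k.+1 t T_cube Tt)).
    by rewrite lef_pV2 ?posrE ?exprn_gt0// ler_eXn2l// ?ltr1n.
  rewrite sumEFin lee_fin big_const_seq count_predT iter_addr_0.
  rewrite -[leLHS]mulr_natl.
  rewrite [leRHS](_ : _ =
      64 ^+ n * 256 ^+ n ^+ k * (C * 2 ^+ m * (4 ^+ m)^-1 ^+ k)).
    by apply: ler_wpM2r => //; rewrite !mulr_ge0 ?exprn_ge0// invr_ge0 exprn_ge0.
  by rewrite /geometric /= /a /z expr_div_n -(exprVn (4 ^+ m)); ring.
have a0 : 0 <= a by rewrite !mulr_ge0 ?exprn_ge0.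
have := ae_cvg_series_geometric _ _ _ _ mf f0 a0 z1 intf.
apply: filterS => w cf t Tt.
apply: (@is_cvg_dominated_increments _ _ (fun k => geometric 1 2^-1 k + f k w)).
  move=> k; rewrite /geometric/= mul1r.
  apply: (le_trans (ler_norm_dyadic m k _ m_gt0)); rewrite lerD2l.
  have pM : (grid_cell k.+1 t, grid_cell k t) \in meeting_cells k.
    by rewrite mem_filter mem_enum andbT; apply/asboolP; exists t.
  rewrite /f (big_rem _ pM)/= lerDl; exact: sumr_ge0.
rewrite (_ : series _ = series (geometric 1 2^-1) \+ series (f ^~ w)); last first.
  by apply/funext => k; rewrite /series/= big_split.
apply: is_cvgD => //; apply: is_cvg_geometric_series.
by rewrite ger0_norm// invf_lt1// ltr1n.
Qed.

Lemma ae_grid_limit t : T t ->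
  {ae P, forall w, (fun k => Z (grid_approx T k t) w) @ \oo --> Z t w}.
Proof.
move=> Tt; pose f k w := incr (2 ^+ k) (grid_approx T k t) t w.
pose z : R := (4 ^+ m)^-1.
have z1 : 0 <= z < 1.
  apply/andP; split; first by rewrite invr_ge0 exprn_ge0.
  by rewrite invf_lt1 ?exprn_gt0// exprn_egt1 ?ltr1n// -lt0n.
have f0 k w : 0 <= f k w by exact: incr_ge0.
have mf k : measurable_fun [set: Omega] (f k) by exact: measurable_incr.
have intf k : (\int[P]_w (f k w)%:E <= (geometric C z k)%:E)%E.
  have [T1 _] := grid_repP T k t Tt.
  rewrite /geometric/= -[C in leRHS]mulr1 -(expr1n _ m).
  apply: integral_incr_le => //.
  by rewrite mul1r distrC; exact: grid_approx_dist.
have := ae_cvg_series_geometric _ _ _ _ mf f0 C_ge0 z1 intf.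
apply: filterS => w cf; apply/subr_cvg0/norm_cvg0P.
have g0 : (fun k => 2^-1 ^+ k + f k w) @ \oo --> (0 : R).
  rewrite -[X in _ --> X]addr0; apply: cvgD; last exact: cvg_series_cvg_0.
  by apply: cvg_expr; rewrite ger0_norm// invf_lt1// ltr1n.
apply: squeeze_cvgr g0; last exact: (cvg_cst (0 : R)).
by apply: nearW => k; rewrite normr_ge0; exact: ler_norm_dyadic.
Qed.

(** Z is kept at the representatives and replaced elsewhere by its limit along
    the grids, written with [limn_esup] so as to be measurable without
    reference to the null set. If the representatives in an open set G have
    their values in a closed set, then so has every point of T in G, as a
    limit of such values. *)
Theorem separable_modification : exists X : 'rV[R]_n -> {RV P >-> R},
  separable_process T X /\ forall t, T t -> {ae P, forall w, X t w = Z t w}.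
Proof.
pose lim_grid t w := fine (limn_esup (fun k => (Z (grid_approx T k t) w)%:E)).
have lim_gridE t w l : (fun k => Z (grid_approx T k t) w) @ \oo --> l ->
    lim_grid t w = l.
  move=> cl; have /cvg_limn_einf_sup[_ lE] :
      (fun k => (Z (grid_approx T k t) w)%:E) @ \oo --> l%:E.
    by apply/fine_cvgP; split; [exact: nearW|exact: cl].
  by rewrite /lim_grid lE.
have mlim t : measurable_fun [set: Omega] (lim_grid t).
  apply: measurableT_comp => //.
  apply: (measurable_fun_limn_esup
    (f := fun k w => (Z (grid_approx T k t) w)%:E)) => k.
  by apply/measurable_EFinP; exact: measurable_funP.
have [Xlim XlimE] : exists Xlim : 'rV[R]_n -> {RV P >-> R},
    forall t, Xlim t = lim_grid t :> (_ -> _).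
  by exists (fun t => mfun_Sub (mem_set (mlim t))).
exists (fun t => if t \in grid_points T then Z t else Xlim t); split; last first.
  move=> t Tt; have := ae_grid_limit t Tt; apply: filterS => w cw.
  by case: ifP => // _; rewrite XlimE; exact: lim_gridE.
exists (grid_points T), (~` [set w | forall t, T t ->
  cvgn (fun k => Z (grid_approx T k t) w)]); split.
- exact: countable_grid_points.
- exact: grid_points_sub.
- exact: grid_points_dense.
- exact: ae_cvg_along_grid.
move=> G F w oG cF /contrapT /= cw XF t [Tt Gt].
case: ifPn => [tS|tS].
  by have := XF t; rewrite tS; apply; split => //; exact: set_mem.
rewrite XlimE; have /cvg_ex[l cl] := cw t Tt; rewrite (lim_gridE t w l cl).
apply: (@closed_cvg _ _ \oo _ (fun k => Z (grid_approx T k t) w)) cl => //.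
have nG : \forall k \near \oo, G (grid_approx T k t).
  exact: (cvg_grid_approx T t T_cube Tt G (open_nbhs_nbhs (conj oG Gt))).
apply: filterS nG => k Gk.
have Sk : grid_points T (grid_approx T k t) by exists k => //; exists t.
by have := XF _ (conj Sk Gk); rewrite mem_set.
Qed.

End kolmogorov.

(** * Square integrable variables and almost sure equality *)

Section square_integrable.
Context {R : realType} {d : measure_display} {Omega : measurableType d}.
Context (P : probability Omega R).
Implicit Types X Y : {RV P >-> R}.

Definition square_integrable X := P.-integrable setT (fun w => (X w ^+ 2)%:E).

Lemma measurable_RV_EFin X : measurable_fun [set: Omega] (fun w => (X w)%:E).
Proof. by apply/measurable_EFinP; exact: measurable_funP. Qed.

(** The integral of a nonnegative function that is a real number is finite, so
    the covariance identities contain the integrability. *)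
Lemma square_integrable_expectation X (v : R) :
  'E_P[(X \* X)%R]%E = v%:E -> square_integrable X.
Proof.
rewrite unlock => EX; apply/integrableP; split.
  by apply/measurable_EFinP; apply: measurable_funX; exact: measurable_funP.
under eq_integral do rewrite gee0_abs ?lee_fin ?sqr_ge0// expr2.
by rewrite [X in (X < _)%E]EX ltry.
Qed.

Lemma square_integrable_mul X Y : square_integrable X -> square_integrable Y ->
  P.-integrable setT (fun w => (X w * Y w)%:E).
Proof.
move=> iX iY; apply: le_integrable (integrableD measurableT iX iY) => //.
  by apply/measurable_EFinP; apply: measurable_funM; exact: measurable_funP.
move=> w _; rewrite -EFinD !abse_EFin lee_fin.
rewrite [leRHS]ger0_norm ?addr_ge0 ?sqr_ge0//.
have := sqr_ge0 (X w - Y w); have := sqr_ge0 (X w + Y w).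
by rewrite ler_norml => *; apply/andP; split; nra.
Qed.

Lemma square_integrable_integrable X : square_integrable X ->
  P.-integrable setT (fun w => (X w)%:E).
Proof.
move=> iX; have i1 : P.-integrable setT (fun=> 1%:E).
  exact: finite_measure_integrable_cst.
apply: le_integrable (integrableD measurableT i1 iX) => //.
  exact: measurable_RV_EFin.
move=> w _; rewrite -EFinD !abse_EFin lee_fin.
rewrite [leRHS]ger0_norm ?addr_ge0 ?sqr_ge0//.
have := sqr_ge0 (X w - 1); have := sqr_ge0 (X w + 1).
by rewrite ler_norml => *; apply/andP; split; nra.
Qed.

Lemma integral_sqrB X Y : square_integrable X -> square_integrable Y ->
  (\int[P]_w ((X w - Y w) ^+ 2)%:E =
   'E_P[(X \* X)%R] + 'E_P[(Y \* Y)%R] - 2%:E * 'E_P[(X \* Y)%R])%E.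
Proof.
move=> iX iY; have iXY := square_integrable_mul X Y iX iY.
have iXX := square_integrable_mul X X iX iX.
have iYY := square_integrable_mul Y Y iY iY.
rewrite unlock -integralZl// -integralD// -integralB//; last 2 first.
- exact: integrableD.
- exact: integrableZl.
by apply: eq_integral => w _ /=; rewrite -!EFinD; congr EFin; ring.
Qed.

Lemma expectation_ae_eq (X Y : Omega -> R) :
  measurable_fun setT X -> measurable_fun setT Y ->
  {ae P, forall w, X w = Y w} -> 'E_P[X]%E = 'E_P[Y]%E.
Proof.
move=> mX mY XY; rewrite unlock; apply: ae_eq_integral => //.
- exact/measurable_EFinP.
- exact/measurable_EFinP.
by apply: filterS XY => w -> _.
Qed.

Lemma pushforward_ae_eq (X Y : Omega -> R) (A : set R) :
  measurable_fun setT X -> measurable_fun setT Y -> measurable A ->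
  {ae P, forall w, X w = Y w} -> pushforward P X A = pushforward P Y A.
Proof.
move=> mX mY mA XY.
have mXA : measurable (X @^-1` A).
  by rewrite -[X in measurable X]setTI; exact: mX.
have mYA : measurable (Y @^-1` A).
  by rewrite -[X in measurable X]setTI; exact: mY.
rewrite /pushforward -(setIT (X @^-1` A)) -(setIT (Y @^-1` A)).
rewrite -!integral_indic//; apply: ae_eq_integral => //.
- by apply/measurable_EFinP; exact: measurable_indic.
- by apply/measurable_EFinP; exact: measurable_indic.
apply: filterS XY => w XY _; congr (_ %:E); rewrite !indicE; congr (_ %:R).
by congr nat_of_bool; apply/idP/idP; rewrite !inE /= XY.
Qed.

End square_integrable.

(** * Gaussian and separable processes *)

Section processes.
Context {R : realType} {d : measure_display} {Omega : measurableType d}.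
Context {P : probability Omega R} {n : nat}.
Implicit Types (T : set 'rV[R]_n) (X Z : 'rV[R]_n -> {RV P >-> R}).

Lemma gaussian_process_ae_eq T X Z :
  (forall t, T t -> {ae P, forall w, X t w = Z t w}) ->
  gaussian_process T Z -> gaussian_process T X.
Proof.
move=> XZ gZ k t c Tt.
have mS (Y : 'rV[R]_n -> {RV P >-> R}) :
    measurable_fun [set: Omega] (fun w => \sum_(j < k) c j * Y (t j) w).
  by apply: measurable_sum => j; apply: measurable_funM.
have E : {ae P, forall w,
    \sum_(j < k) c j * X (t j) w = \sum_(j < k) c j * Z (t j) w}.
  have : {ae P, forall w, forall j, X (t j) w = Z (t j) w}.
    by apply: filter_forall => j; exact: XZ.
  by apply: filterS => w H; apply: eq_bigr => j _; rewrite H.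
have EA A : measurable A -> _ :=
  fun mA => pushforward_ae_eq P _ _ A (mS X) (mS Z) mA E.
have [[m Hm]|[m [s [s0 Hs]]]] := gZ k t c Tt.
- by left; exists m => A mA; rewrite EA// Hm.
- by right; exists m, s; split => // A mA; rewrite EA// Hs.
Qed.

Lemma separable_process_eq T X Z : (forall t, T t -> X t = Z t) ->
  separable_process T Z -> separable_process T X.
Proof.
move=> XZ [S [N [cS ST TS nN H]]]; exists S, N; split => //.
move=> G F w oG cF Nw HS t TGt.
rewrite XZ; last exact: TGt.1.
by apply: H TGt => // s SGs; rewrite -XZ; [exact: HS|exact: ST SGs.1].
Qed.

Lemma separable_processU T1 T2 X : separable_process T1 X ->
  separable_process T2 X -> separable_process (T1 `|` T2) X.
Proof.
move=> [S1 [N1 [cS1 ST1 TS1 nN1 H1]]] [S2 [N2 [cS2 ST2 TS2 nN2 H2]]].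
exists (S1 `|` S2), (N1 `|` N2); split.
- by rewrite -bigcup2E; apply: bigcup_countable => // -[|[|i]] _ //=.
- exact: setUSS.
- by move=> t [/TS1|/TS2]; apply: closureS; [exact: subsetUl|exact: subsetUr].
- exact: negligibleU.
- move=> G F w oG cF /not_orP[Nw1 Nw2] HS t [[T1t|T2t] Gt].
    by apply: (H1 G F w) => // s [Ss Gs]; apply: HS; split => //; left.
  by apply: (H2 G F w) => // s [Ss Gs]; apply: HS; split => //; right.
Qed.

(** When the paths are constant on T, any countable dense subset of T is a
    separant. *)
Lemma separable_process_const T X : T `<=` unit_cube ->
  (forall s t, T s -> T t -> X s = X t) -> separable_process T X.
Proof.
move=> TK cX; exists (grid_points T), set0; split.
- exact: countable_grid_points.
- exact: grid_points_sub.
- exact: grid_points_dense.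
- exact: negligible_set0.
- move=> G F w oG cF _ HS t [Tt Gt].
  have nG : nbhs t G := open_nbhs_nbhs (conj oG Gt).
  have [s [Ss Gs]] := grid_points_dense T TK t Tt G nG.
  by rewrite (cX t s)//; [exact: HS|exact: grid_points_sub Ss].
Qed.

End processes.

(** * Brownian sheets as modifications of Gaussian fields *)

Section sheet_increments.
Context {R : realType}.

Lemma ler_prodB (I : Type) (r : seq I) (x y : I -> R) :
  (forall i, 0 <= x i <= y i) -> (forall i, y i <= 1) ->
  \prod_(i <- r) y i - \prod_(i <- r) x i <= \sum_(i <- r) (y i - x i).
Proof.
move=> xy y1.
suff [] : 0 <= \prod_(i <- r) x i <= \prod_(i <- r) y i /\
    \prod_(i <- r) y i <= 1 /\
    \prod_(i <- r) y i - \prod_(i <- r) x i <= \sum_(i <- r) (y i - x i).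
  by move=> _ [].
elim: r => [|i r [/andP[H0 H1] [H2 H3]]].
  by rewrite !big_nil subrr ler01 !lexx.
rewrite !big_cons; have /andP[x0 xyi] := xy i; have := y1 i.
move: (x i) (y i) x0 xyi H0 H1 H2 H3 => a b.
move: (\prod_(j <- r) x j) (\prod_(j <- r) y j) (\sum_(j <- r) _) => p q s *.
split; first by apply/andP; split; nra.
by split; nra.
Qed.

(** The variance of an increment is the sum of \prod s - \prod min(s, t) and
    \prod t - \prod min(s, t); each is bounded coordinatewise. *)
Lemma sheet_increment_le n (s t : 'rV[R]_n) : unit_cube s -> unit_cube t ->
  \prod_(i < n) s 0 i + \prod_(i < n) t 0 i -
    2 * \prod_(i < n) Num.min (s 0 i) (t 0 i) <= 2 * n%:R * `|s - t|.
Proof.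
suff H (x y : 'rV[R]_n) : unit_cube x -> unit_cube y ->
    \prod_(i < n) x 0 i - \prod_(i < n) Num.min (x 0 i) (y 0 i) <=
    n%:R * `|x - y|.
  move=> Ks Kt; have := H s t Ks Kt; have := H t s Kt Ks.
  rewrite distrC (eq_bigr _ (fun i _ => minC _ _)); lra.
move=> Kx Ky; apply: (le_trans (ler_prodB _ _ _ _ _ _)).
- move=> i; rewrite ge_min lexx le_min.
  by have /andP[-> _] := Kx i; have /andP[-> _] := Ky i.
- by move=> i; have /andP[] := Kx i.
rewrite (_ : n%:R * _ = \sum_(i < n) `|x - y|); last first.
  by rewrite big_const cardT/= size_enum_ord iter_addr_0 mulr_natl.
apply: ler_sum => i _; apply: le_trans (coord_le_norm_rV _ i).
rewrite !mxE; case: (leP (x 0 i) (y 0 i)) => h; first by rewrite subrr.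
exact: ler_norm.
Qed.

End sheet_increments.

Section sheet.
Context {R : realType} {d : measure_display} {Omega : measurableType d}.
Context (P : probability Omega R) {n : nat} (T : set 'rV[R]_n).
Context (Z : 'rV[R]_n -> {RV P >-> R}).
Hypothesis T_cube : T `<=` unit_cube.
Hypothesis Z_gaussian : gaussian_process T Z.
Hypothesis Z_mean : forall s, T s -> ('E_P[Z s] = 0)%E.
Hypothesis Z_covariance : forall s t, T s -> T t ->
  ('E_P[(Z s \* Z t)%R])%E = (\prod_(i < n) Num.min (s 0 i) (t 0 i))%:E.

Let Z_variance s : T s -> ('E_P[(Z s \* Z s)%R])%E = (\prod_(i < n) s 0 i)%:E.
Proof.
by move=> Ts; rewrite Z_covariance//; under eq_bigr do rewrite minxx.
Qed.

Let Z_square_integrable s : T s -> square_integrable P (Z s).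
Proof. by move=> Ts; apply: square_integrable_expectation (Z_variance s Ts). Qed.

Let sheet_variance_increment s t : T s -> T t ->
  (\int[P]_w ((Z s w - Z t w) ^+ 2)%:E <= (2 * n%:R * `|s - t|)%:E)%E.
Proof.
move=> Ts Tt; rewrite integral_sqrB; try exact: Z_square_integrable.
rewrite !Z_variance// Z_covariance// lee_fin.
by apply: sheet_increment_le; exact: T_cube.
Qed.

Let sheet_moment_increment m : exists2 C : R, 0 <= C & forall s t, T s -> T t ->
  (\int[P]_w ((Z s w - Z t w) ^+ m.*2)%:E <= (C * `|s - t| ^+ m)%:E)%E.
Proof.
have [C C0 HC] := gaussian_moment_le R m.
exists (C * (2 * n%:R) ^+ m); first by rewrite mulr_ge0 ?exprn_ge0 ?mulr_ge0.
move=> s t Ts Tt; rewrite -mulrA -exprMn.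
pose W : {RV P >-> R} := (Z s \- Z t)%R.
apply: (HC _ _ P W); last exact: sheet_variance_increment.
have := Z_gaussian 2 (fun j => if j == ord0 then s else t)
  (fun j => if j == ord0 then 1 else -1).
have -> : (fun w => \sum_(j < 2) (if j == ord0 then 1 else -1) *
    Z (if j == ord0 then s else t) w) = W.
  by apply/funext => w; rewrite !big_ord_recl big_ord0 /= mul1r mulN1r addr0.
by apply => j; case: ifP.
Qed.

Let Z_face t : T t -> coordinate_faces t -> {ae P, forall w, Z t w = 0}.
Proof.
move=> Tt t0; have : (\int[P]_w `|(Z t w ^+ 2)%:E| = 0)%E.
  have := Z_variance t Tt; rewrite t0 unlock => E; rewrite -[RHS]E.
  by apply: eq_integral => w _; rewrite gee0_abs ?lee_fin ?sqr_ge0// expr2.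
move/ae_eq_integral_abs => H.
have := H measurableT (measurable_int _ (Z_square_integrable t Tt)).
by apply: filterS => w /(_ I) [] /eqP; rewrite sqrf_eq0 => /eqP.
Qed.

(** The modification obtained off the coordinate faces is extended by 0 to the
    faces; the two parts are separable and so is their union. *)
Theorem brownian_sheet_modification :
  exists X : 'rV[R]_n -> {RV P >-> R},
  brownian_sheet T X /\ forall t, T t -> {ae P, forall w, X t w = Z t w}.
Proof.
pose D := T `\` coordinate_faces.
have [C C0 HC] := sheet_moment_increment (4 * n).+1.
have [X' [sepX' X'Z]] := separable_modification P D Z (4 * n).+1 C
  (subset_trans (@subDsetl _ T _) T_cube) (ltnSn _) C0
  (fun s t Ds Dt => HC s t Ds.1 Dt.1).
pose X t : {RV P >-> R} :=
    if `[< coordinate_faces t >] then (cst 0 : {RV P >-> R}) else X' t.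
have X0 t : coordinate_faces t -> forall w, X t w = 0.
  by move=> t0 w; rewrite /X asboolT.
have XZ t : T t -> {ae P, forall w, X t w = Z t w}.
  move=> Tt; rewrite /X; case: asboolP => t0; last exact: X'Z.
  by apply: filterS (Z_face t Tt t0) => w ->.
have mX (Y : 'rV[R]_n -> {RV P >-> R}) s : measurable_fun [set: Omega] (Y s).
  exact: measurable_funP.
exists X; split => //; split.
- rewrite (_ : T = D `|` (T `&` coordinate_faces)); last first.
    by rewrite setUC setUIDK.
  apply: separable_processU.
    by apply: separable_process_eq sepX' => t [_ t0]; rewrite /X asboolF.
  apply: separable_process_const.
    exact: subset_trans (@subIsetl _ _ _) T_cube.
  by move=> s t [_ s0] [_ t0]; rewrite /X !asboolT.
- exact: gaussian_process_ae_eq XZ Z_gaussian.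
- by move=> s _ s0; exact: X0.
- move=> s Ts; rewrite -(Z_mean s Ts).
  by apply: expectation_ae_eq => //; exact: XZ.
- move=> s t Ts Tt; rewrite -(Z_covariance s t Ts Tt).
  apply: expectation_ae_eq; try exact: measurable_funM.
  by apply: filterS2 (XZ s Ts) (XZ t Tt) => w /= -> ->.
Qed.

End sheet.

(** * The time change *)

Section time_change.
Context {R : realType}.
Implicit Types u v : R -> R.

Lemma time_change_invP u v r : time_change_range u v r ->
  time_change_dom u (time_change_inv u v r) /\
  time_change u v (time_change_inv u v r) = r.
Proof.
move=> ur; split; last by rewrite /time_change_inv pinvK//; exact: mem_set.
apply: (surjpinv_image_sub (B := time_change_range u v)); last by exists r.
by move=> x.
Qed.

(** A decreasing time change exchanges max and min. *)
Lemma time_change_min u v :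
  (forall x y, time_change_dom u x -> time_change_dom u y -> x < y ->
    time_change u v y < time_change u v x) ->
  forall x y, time_change_dom u x -> time_change_dom u y ->
  u (Num.min x y) * v (Num.max x y) / (u x * u y) =
  Num.min (time_change u v x) (time_change u v y).
Proof.
move=> dec x y; wlog xy : x y / x <= y.
  move=> H Dx Dy; have /orP[xy|yx] := le_total x y; first exact: H.
  by rewrite minC maxC (mulrC (u x)) H// minC.
move=> Dx Dy; have [_ ux] := Dx; have [_ uy] := Dy.
rewrite (min_idPl xy) (max_idPr xy) (min_idPr _); last first.
  by move: xy; rewrite le_eqVlt => /predU1P[->//|xy]; apply/ltW/dec.
by rewrite /time_change -mulf_div mulfV// mul1r.
Qed.

End time_change.

Theorem lemma3p2 (R : realType) (d : measure_display)
  (Omega : measurableType d) (P : probability Omega R)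
  (n : nat) (n_gt0 : (0 < n)%N)
  (u v : 'I_n -> R -> R) (Y : 'rV[R]_n -> {RV P >-> R})
  (Y_gaussian : gaussian_process orthant Y)
  (Y_mean : forall s, orthant s -> ('E_P[Y s] = 0)%E)
  (Y_covariance : forall s t, orthant s -> orthant t ->
    ('E_P[(Y s \* Y t)%R])%E =
      (\prod_(i < n) (u i (Num.min (s 0 i) (t 0 i)) *
                      v i (Num.max (s 0 i) (t 0 i))))%:E)
  (a_decreasing : forall i x y, time_change_dom (u i) x -> time_change_dom (u i) y ->
    x < y -> time_change (u i) (v i) y < time_change (u i) (v i) x)
  (a_continuous : forall i,
    {within time_change_dom (u i), continuous (time_change (u i) (v i))}) :
  exists X : 'rV[R]_n -> {RV P >-> R},
    brownian_sheet (sheet_dom u v) X /\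
    stochastically_equivalent P (normalized_dom u v) (normalized_field u v Y) X.
Proof.
(* The points of sheet_dom off the normalized domain lie on the faces, where
   the Brownian sheet vanishes: Z is set to 0 there. *)
pose N t := `[< normalized_dom u v t >].
pose x t : 'rV[R]_n :=
  if N t then \row_i time_change_inv (u i) (v i) (t 0 i) else 0.
pose c t : R := if N t then (\prod_(i < n) u i (x t 0 i))^-1 else 0.
pose Z t : {RV P >-> R} := (c t \o* Y (x t))%R.
have x_dom t i : normalized_dom u v t -> time_change_dom (u i) (x t 0 i) /\
    time_change (u i) (v i) (x t 0 i) = t 0 i.
  move=> Nt; rewrite /x /N asboolT// mxE.
  by apply: time_change_invP; exact: Nt.2.
have x_orthant t : orthant (x t).
  rewrite /orthant /=; have [Nt i|Nt i] := pselect (normalized_dom u v t).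
    by have [[]] := x_dom t i Nt.
  by rewrite /x /N asboolF// mxE.
have Y_sqr s : orthant s -> square_integrable P (Y s).
  by move=> Ks; apply: square_integrable_expectation (Y_covariance s s Ks Ks).
have Z_gaussian : gaussian_process (sheet_dom u v) Z.
  move=> k t b _.
  have := Y_gaussian k (fun j => x (t j)) (fun j => b j * c (t j))
    (fun j => x_orthant (t j)).
  congr (gaussian_law (pushforward P _)); apply/funext => w.
  by apply: eq_bigr => j _; rewrite /Z /= -mulrA (mulrC (c _)).
have Z_mean s : sheet_dom u v s -> ('E_P[Z s] = 0)%E.
  move=> _; rewrite expectationZl ?Y_mean ?mule0//.
  by apply/Lfun1_integrable; apply: square_integrable_integrable; exact: Y_sqr.
have Z_covariance s t : sheet_dom u v s -> sheet_dom u v t ->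
    ('E_P[(Z s \* Z t)%R])%E = (\prod_(i < n) Num.min (s 0 i) (t 0 i))%:E.
  move=> Ts Tt.
  have -> : ('E_P[(Z s \* Z t)%R] =
      (c s * c t)%:E * 'E_P[(Y (x s) \* Y (x t))%R])%E.
    rewrite unlock -integralZl//; last first.
      by apply: square_integrable_mul; exact: Y_sqr.
    by apply: eq_integral => w _; rewrite -EFinM; congr EFin => /=; ring.
  rewrite Y_covariance// -EFinM; congr EFin.
  have face r r' : sheet_dom u v r -> unit_cube r' -> ~ normalized_dom u v r ->
      \prod_(i < n) Num.min (r 0 i) (r' 0 i) = 0.
    move=> [//|[Kr]] /eqP/prodf_eq0[i _ /eqP ri] Kr' _.
    apply/eqP/prodf_eq0; exists i => //; rewrite ri (min_idPl _)//.
    by have /andP[] := Kr' i.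
  have cube r : sheet_dom u v r -> unit_cube r by move=> [[]|[]].
  have [Ns|Ns] := pselect (normalized_dom u v s); last first.
    by rewrite (face s t)//; [rewrite /c /N asboolF// !mul0r|exact: cube].
  have [Nt|Nt] := pselect (normalized_dom u v t); last first.
    under [RHS]eq_bigr do rewrite minC.
    by rewrite (face t s)//; [rewrite /c /N (asboolF Nt) mulr0 mul0r|exact: cube].
  rewrite /c /N !asboolT// -invfM mulrC -big_split /= -prodf_div.
  apply: eq_bigr => i _.
  have [Ds Es] := x_dom s i Ns; have [Dt Et] := x_dom t i Nt.
  by rewrite (time_change_min _ _ (a_decreasing i))// Es Et.
have cube : sheet_dom u v `<=` unit_cube by move=> t [[]|[]].
have [X [sheetX XZ]] :=
  brownian_sheet_modification P _ Z cube Z_gaussian Z_mean Z_covariance.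
exists X; split=> // t Nt.
have ZE w : normalized_field u v Y t w = Z t w.
  rewrite /normalized_field /Z /c /x /N /= !asboolT//; congr (_ / _).
  by apply: eq_bigr => i _; rewrite mxE.
(* Z t - X t has almost surely the value 0, hence the same law as cst 0. *)
have mD : measurable_fun [set: Omega] (fun w => Z t w - X t w).
  by apply: measurable_funB; exact: measurable_funP.
have D0 : {ae P, forall w, Z t w - X t w = 0}.
  by apply: filterS (XZ t (or_introl Nt)) => w ->; rewrite subrr.
have :=
  pushforward_ae_eq P _ (cst 0) [set 0] mD (measurable_cst _) (measurable_set1 _) D0.
rewrite /pushforward preimage_cst mem_set// probability_setT => <-.
congr (P _); apply/seteqP; split=> w ZX.
  by apply/eqP; rewrite subr_eq0; apply/eqP; rewrite -[LHS]ZE; exact: ZX.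
by rewrite /mkset ZE; apply: subr0_eq; exact: ZX.
Qed.
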